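(* Let $\kappa$ be an uncountable cardinal. Consider the statements: (1) ${\sf BC}_\kappa$; (2) ${\sf BC}({}^\kappa2,\kappa)$; (3) $\neg{\sf KH}(\kappa,\aleph_1)$; (4) $\neg{\sf KH}(\kappa,\kappa)$. Each statement implies all the succeeding ones. If Borel's Conjecture ${\sf BC}$ holds, then (1)–(3) are equivalent. If ${\sf BC}_\lambda$ holds for every infinite cardinal $\lambda<\kappa$, then all four statements are equivalent.
   Context: All topological groups are assumed Tychonoff. ${}^\kappa2$ is the group of functions $\kappa\to\{0,1\}$ with coordinatewise addition mod 2 and product topology. A topological group $(G,* )$ is $\aleph_0$-bounded if for every open neighborhood $U$ of the identity countably many translates of $U$ cover $G$. A subset $X$ of $G$ is Rothberger bounded if for every sequence $(U_n:n<\omega)$ of open neighborhoods of the identity there are $g_n\in G$ with $X\subseteq\bigcup_n g_n*U_n$. For infinite $\lambda$, ${\sf BC}_\lambda$: every Rothberger bounded subset of an $\aleph_0$-bounded topological group of weight $\lambda$ has cardinality at most $\lambda$; ${\sf BC}={\sf BC}_{\aleph_0}$ is Borel's Conjecture. ${\sf BC}({}^\kappa2,\kappa)$: every Rothberger bounded subset of ${}^\kappa2$ has cardinality at most $\kappa$. For uncountable $\lambda\le\kappa$, a $(\kappa,\lambda)$ Kurepa family is a family $\mathcal F$ of subsets of $\kappa$ with $|\mathcal F|>\kappa$ such that for every infinite $A\subseteq\kappa$ with $|A|<\lambda$, $|\{X\cap A:X\in\mathcal F\}|\le|A|$; ${\sf KH}(\kappa,\lambda)$ asserts such a family exists. *)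

(* Defs.v *)
From HB Require Import structures.
From mathcomp Require Import all_boot all_order all_algebra.
From mathcomp Require Import all_classical all_reals all_analysis.

Set Implicit Arguments.
Unset Strict Implicit.
Unset Printing Implicit Defensive.

Local Open Scope classical_set_scope.
Local Open Scope card_scope.

Definition card_lt T U (A : set T) (B : set U) := A #<= B /\ ~ (B #<= A).

Definition tychonoff_space (T : topologicalType) :=
  accessible_space T /\ completely_regular_space T.

Record topGroup := TopGroup {
  tg_carrier :> topologicalType;
  tg_mul : tg_carrier -> tg_carrier -> tg_carrier;
  tg_inv : tg_carrier -> tg_carrier;
  tg_one : tg_carrier;
  tg_mulA : forall x y z, tg_mul x (tg_mul y z) = tg_mul (tg_mul x y) z;
  tg_mul1g : forall x, tg_mul tg_one x = x;
  tg_mulVg : forall x, tg_mul (tg_inv x) x = tg_one;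
  tg_mul_cont : continuous (fun p : tg_carrier * tg_carrier => tg_mul p.1 p.2);
  tg_inv_cont : continuous tg_inv;
  tg_tych : tychonoff_space tg_carrier
}.

Definition ltrans (G : Type) (mul : G -> G -> G) (g : G) (U : set G) : set G :=
  [set mul g u | u in U].

Definition rothberger_bounded (G : topologicalType) (mul : G -> G -> G) (e : G)
  (X : set G) :=
  forall U : nat -> set G, (forall n, open_nbhs e (U n)) ->
  exists g : nat -> G, X `<=` \bigcup_n ltrans mul (g n) (U n).

Definition aleph0_bounded (G : topGroup) :=
  forall U : set G, open_nbhs (tg_one G) U ->
  exists g : nat -> G, [set: G] `<=` \bigcup_n ltrans (@tg_mul G) (g n) U.

Definition is_base (T : topologicalType) (B : set (set T)) :=
  (forall V, B V -> open V) /\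
  (forall U : set T, open U -> forall x, U x -> exists2 V, B V & V x /\ V `<=` U).

Definition has_weight (T : topologicalType) (L : Type) (Lam : set L) :=
  (exists2 B : set (set T), is_base B & B #= Lam) /\
  (forall B : set (set T), is_base B -> Lam #<= B).

Definition BC_card (L : Type) (Lam : set L) :=
  forall G : topGroup, aleph0_bounded G -> has_weight G Lam ->
  forall X : set G, rothberger_bounded (@tg_mul G) (tg_one G) X -> X #<= Lam.

Definition BorelConjecture := BC_card [set: nat].

Definition cantor_group (K : Type) := prod_topology (fun _ : K => bool).
Definition cantor_add (K : Type) (f g : cantor_group K) : cantor_group K :=
  fun i => xorb (f i) (g i).
Definition cantor_zero (K : Type) : cantor_group K := fun _ => false.

Definition BC_cantor (K : Type) :=
  forall X : set (cantor_group K),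
  rothberger_bounded (@cantor_add K) (@cantor_zero K) X -> X #<= [set: K].

(** (kappa, lambda) Kurepa family; [below_lambda A] encodes |A| < lambda *)
Definition kurepa_family (K : Type) (below_lambda : set K -> Prop)
  (F : set (set K)) :=
  card_lt [set: K] F /\
  forall A : set K, infinite_set A -> below_lambda A ->
    [set X `&` A | X in F] #<= A.

(** KH(kappa, aleph_1): |A| < aleph_1 means A countable *)
Definition KH_aleph1 (K : Type) :=
  exists F : set (set K), kurepa_family (fun A : set K => countable A) F.

Definition KH_kappa (K : Type) :=
  exists F : set (set K), kurepa_family (fun A : set K => card_lt A [set: K]) F.

(* Main.v *)
(** (1) -> (2) holds because 2^kappa is an aleph_0-bounded group of weight kappa.
    For (2) -> (3), a basic neighbourhood of 0 in 2^kappa restricts only finitely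
    many coordinates, so countably many of them only see a countable A; as a Kurepa
    family has countably many traces on A, it is Rothberger bounded.  If
    BC_lambda holds for lambda = |A| < kappa, the restriction of that family to 2^A is
    still Rothberger bounded, hence of size at most |A|: this turns a
    (kappa, aleph_1) Kurepa family into a (kappa, kappa) one.

    For (3) -> (1) under BC, let X be Rothberger bounded in an aleph_0-bounded G of
    weight kappa.  Any countably many neighbourhoods of 1 contain a normal
    subgroup N, itself an intersection of countably many neighbourhoods, with a
    coarser second countable topology on G/N; by BC, X meets only countably many
    cosets of N.  Take such an N_V for each V in a base of size kappa, and number
    the cosets of N_V that meet X by c_V : X -> nat.  If |X| > kappa, the graphs
    {(V, c_V x) : V} of the points x of X form a Kurepa family on
    kappa * nat = kappa. *)
Require Import Defs.
From HB Require Import structures.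
From mathcomp Require Import all_boot all_order all_algebra.
From mathcomp Require Import all_classical all_reals all_analysis.
From Stdlib Require List.
Local Open Scope classical_set_scope.
Local Open Scope card_scope.

(** * Cardinal arithmetic *)

(** Choice turns [R] into a function, injective by the second hypothesis. The relational form spares
    explicit coding functions. *)
Lemma card_le_rel {T U : Type} {A : set T} {B : set U} (R : T -> U -> Prop) :
  (forall x, A x -> exists2 y, B y & R x y) ->
  (forall x x' y, A x -> A x' -> R x y -> R x' y -> x = x') ->
  A #<= B.
Proof.
move=> Rtot Rinj; apply/card_leP/injfunPex.
have ex (x : A) : exists y : B, R (set_val x) (set_val y).
  have Ax := set_valP x; have [y By Rxy] := Rtot _ Ax.
  by exists (SigSub (mem_set By)).
have [f fP] := choice ex.
exists f => // x y _ _ fxy; apply: val_inj.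
by apply: (Rinj _ _ (set_val (f x)));
  [exact: set_valP|exact: set_valP|exact: fP|rewrite fxy; exact: fP].
Qed.

Lemma card_le_fun {T U : Type} {A : set T} {B : set U} (f : T -> U) :
  (forall x, A x -> B (f x)) ->
  (forall x y, A x -> A y -> f x = f y -> x = y) -> A #<= B.
Proof.
move=> fAB finj; apply: (card_le_rel (fun x y => f x = y)) => [x Ax|x x' y Ax Ax'].
  by exists (f x) => //; exact: fAB.
by move=> <- /esym; exact: finj.
Qed.

(** The default [u0] extends the injection to all of [T], which keeps subtypes out of later
    arguments. *)
Lemma card_leP_fun {T U : Type} {A : set T} {B : set U} (u0 : U) :
  A #<= B -> exists f : T -> U,
  (forall x, A x -> B (f x)) /\ (forall x y, A x -> A y -> f x = f y -> x = y).
Proof.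
move=> /card_leP[h].
have ex (x : T) : exists y : U, forall Ax : x \in A, y = set_val (h (SigSub Ax)).
  have [Ax|nAx] := pselect (x \in A); last by exists u0.
  by exists (set_val (h (SigSub Ax))) => Ax'; rewrite (bool_irrelevance Ax Ax').
have [f fP] := choice ex; exists f; split=> [x Ax|x y Ax Ay].
  by rewrite (fP _ (mem_set Ax)); exact: set_valP.
rewrite (fP _ (mem_set Ax)) (fP _ (mem_set Ay)) => /val_inj /inj.
by rewrite !inE => /(_ I I) [].
Qed.

Lemma card_le_total {T U : Type} (A : set T) (B : set U) : A #<= B \/ B #<= A.
Proof.
pose P (R : set (T * U)) := [/\ R `<=` A `*` B,
  (forall x x' y, R (x, y) -> R (x', y) -> x = x') &
  (forall x y y', R (x, y) -> R (x, y') -> y = y')].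
have [F FP Ftot|M [[MAB Minj Mfun] Mmax]] := @Zorn_bigcup _ P.
  split=> [p [R FR Rp]|x x' y [R FR Rx] [R' FR' Rx']|x y y' [R FR Rx] [R' FR' Rx']].
  - by have [+ _ _] := FP R FR; apply.
  - have [sub|sub] := Ftot _ _ FR FR'.
      by have [_ + _] := FP R' FR'; apply; eauto.
    by have [_ + _] := FP R FR; apply; eauto.
  - have [sub|sub] := Ftot _ _ FR FR'.
      by have [_ _] := FP R' FR'; apply; eauto.
    by have [_ _] := FP R FR; apply; eauto.
have [Adom|/existsNP[a]] := pselect (forall x, A x -> exists y, M (x, y)).
  left; apply: (card_le_rel (fun x y => M (x, y))) => [x Ax|x x' y _ _]; last exact: Minj.
  by have [y Mxy] := Adom x Ax; exists y => //; have [] := MAB _ Mxy.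
move=> /not_implyP[Aa aM].
have [Bdom|/existsNP[b]] := pselect (forall y, B y -> exists x, M (x, y)).
  right; apply: (card_le_rel (fun y x => M (x, y))) => [y By|y y' x _ _]; last exact: Mfun.
  by have [x Mxy] := Bdom y By; exists x => //; have [] := MAB _ Mxy.
move=> /not_implyP[Bb bM].
exfalso; apply: (Mmax (M `|` [set (a, b)])).
  split; first by move=> p Mp; left.
  by move=> /(_ (a, b)) /= h; apply: aM; exists b; apply: h; right.
split=> [p [/MAB//|->]//|x x' y|x y y'].
- move=> [Mx|[-> ->]] [Mx'|[]]; first exact: Minj Mx Mx'.
  + by move=> _ yb; case: bM; exists x; rewrite -yb.
  + by case: bM; exists x'.
  + by move=> ->.
- move=> [Mx|[-> ->]] [Mx'|[]]; first exact: Mfun Mx Mx'.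
  + by move=> xa _; case: aM; exists y; rewrite -xa.
  + by case: aM; exists y'.
  + by move=> ->.
Qed.

Lemma infinite_inj_nat {T : Type} {A : set T} : infinite_set A ->
  exists d : nat -> T, (forall n, A (d n)) /\ injective d.
Proof.
move=> infA; have [t0 _] := infinite_setN0 infA.
move/infiniteP: infA => /(card_leP_fun t0)[d [dA dinj]].
by exists d; split=> [n|m n]; [exact: dA|exact: dinj].
Qed.


Lemma card_seq_le (T : Type) : infinite_set [set: T] ->
  [set: seq T] #<= [set: T].
Proof.
move=> /infinite_inj_nat[d [_ dinj]].
(* Zorn on graphs of injections [seq A -> A]: if [A] is maximal then its complement
   is no larger than [A], since otherwise the injection extends to [A] plus a
   disjoint copy [A'] of [A]. *)
pose good (A : set T) (R : set (seq T * T)) := [/\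
  (forall s y, R (s, y) -> List.Forall A s /\ A y),
  (forall s, List.Forall A s -> exists y, R (s, y)),
  (forall s s' y, R (s, y) -> R (s', y) -> s = s') &
  (forall s y y', R (s, y) -> R (s, y') -> y = y')].
pose P R := R = set0 \/ exists A, good A R.
have [F FP Ftot|M [PM Mmax]] := @Zorn_bigcup _ P.
  have [->|[R1 [FR1 R1ne]]] : 
      \bigcup_(X in F) X = set0 \/ exists R, F R /\ R <> set0.
  - have [h|h] := pselect (exists R, F R /\ R <> set0); first by right.
    left; apply/seteqP; split=> // p [R FR Rp]; apply: h.
    by exists R; split=> // R0; rewrite R0 in Rp.
  - by left.
  pose A := [set x | exists2 R, F R & exists2 B, good B R & B x].
  right; exists A.
  have up R B : F R -> good B R -> B `<=` A.
    by move=> FR gB x Bx; exists R => //; exists B.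
  have Fgood R p : F R -> R p -> exists B, good B R.
    by move=> /FP[->|//].
  have two R R' p q : F R -> R p -> F R' -> R' q ->
     exists R2 B, [/\ good B R2, R2 p & R2 q].
    move=> FR Rp FR' Rq; have [sub|sub] := Ftot _ _ FR FR'.
      by have [B gB] := Fgood _ _ FR' Rq; exists R', B; split=> //; exact: sub.
    by have [B gB] := Fgood _ _ FR Rp; exists R, B; split=> //; exact: sub.
  (* A list has finitely many entries, so one member of the chain handles them all; bases grow with
     the relations, as one-entry lists show. *)
  have dom s : List.Forall A s -> exists R B, [/\ F R, good B R & List.Forall B s].
    elim=> [|x l [R FR [B gB Bx]] _ [R' [B' [FR' gB' B'l]]]].
      by have [//|[B gB]] := FP _ FR1; exists R1, B; split.
    have mono (Q Q' : set (seq T * T)) C C' : good C Q -> good C' Q' -> Q `<=` Q' -> C `<=` C'.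
      move=> [_ Ctot _ _] [C'sub _ _ _] sub c Cc.
      have [y /sub /C'sub [+ _]] := Ctot [:: c] (List.Forall_cons _ Cc (List.Forall_nil _)).
      by move=> h; inversion h.
    have [sub|sub] := Ftot _ _ FR FR'.
      exists R', B'; split=> //; apply: List.Forall_cons => //.
      exact: (mono _ _ _ _ gB gB').
    exists R, B; split=> //; apply: List.Forall_cons => //.
    by apply: List.Forall_impl B'l; exact: (mono _ _ _ _ gB' gB).
  split=> [s y [R FR Rs]|s /dom[R [B [FR gB Bs]]]|s s' y [R FR Rs] [R' FR' Rs']|s y y' [R FR Rs] [R' FR' Rs']].
  - have [B gB] := Fgood _ _ FR Rs; have [/(_ _ _ Rs)[Bs By] _ _ _] := gB.
    by split; [apply: List.Forall_impl Bs; exact: up FR gB|exact: up FR gB _ By].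
  - by have [_ /(_ s Bs)[y Ry] _ _] := gB; exists y, R.
  - by have [R2 [B [[_ _ inj2 _]]]] := two _ _ _ _ FR Rs FR' Rs'; exact: inj2.
  - by have [R2 [B [[_ _ _ fun2]]]] := two _ _ _ _ FR Rs FR' Rs'; exact: fun2.
have mapinj : injective (map d) by exact: inj_map.
(* A maximal relation is not empty: lists over [range d] can be coded through [pickle]. *)
have [M0|[A [MA Mtot Minj Mfun]]] := PM.
  exfalso; apply: (Mmax [set p | exists2 l, p.1 = map d l & p.2 = d (pickle l)]).
    by rewrite M0; split=> // /(_ ([::], d (pickle (Nil nat)))); apply; exists [::].
  right; exists (range d); split.
  - move=> s y [/= l -> ->]; split; last by exists (pickle l).
    by apply/List.Forall_forall => x /List.in_map_iff[n [<- _]]; exists n.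
  - move=> s ds; suff [l ->] : exists l, s = map d l by eexists; exists l.
    elim: ds => [|x l [n _ <-] _ [k ->]]; first by exists [::].
    by exists (n :: k).
  - by move=> s s' y [/= l -> ->] [/= l' -> /dinj /(pcan_inj pickleK) ->].
  - by move=> s y y' [/= l -> ->] [/= l' /mapinj -> ->].
have [f fP] : exists f : seq T -> T, forall s, List.Forall A s -> M (s, f s).
  have h (s : seq T) : exists y, List.Forall A s -> M (s, y).
    have [/Mtot[y]|] := pselect (List.Forall A s); first by exists y.
    by exists (d 0%N).
  by have [f] := choice h; exists f.
have fA s : List.Forall A s -> A (f s) by move=> /fP /MA[].
have finj s s' : List.Forall A s -> List.Forall A s' -> f s = f s' -> s = s'.
  by move=> /fP Ms /fP + fss'; rewrite -fss' => /(Minj _ _ _ Ms).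
have F1 a : A a -> List.Forall A [:: a] by move=> Aa; constructor.
have F2 a : A a -> List.Forall A [:: a; a] by move=> Aa; constructor; [|exact: F1].
(* Points of [A] are sent to one-entry lists and points of [C] to two-entry lists over [A]; [f]
   codes both kinds without collision. *)
have fold (C : set T) (g : T -> T) : (forall x, C x -> A (g x)) ->
   (forall x y, C x -> C y -> g x = g y -> x = y) -> C `&` A = set0 ->
   exists k : T -> T, (forall x, (A `|` C) x -> A (k x)) /\
     (forall x y, (A `|` C) x -> (A `|` C) y -> k x = k y -> x = y).
  move=> gA ginj CA.
  have disj x : C x -> A x -> False by move=> Cx Ax; suff : (C `&` A) x by rewrite CA.
  exists (fun x => if pselect (A x) then f [:: x] else f [:: g x; g x]).
  split=> [x|x y].
    by case: pselect => [Ax _|nAx [//|Cx]]; apply: fA; [exact: F1|apply/F2/gA].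
  case: pselect => [Ax _|nAx [//|Cx]]; case: pselect => [Ay _|nAy [//|Cy]].
  - by move=> /finj-/(_ (F1 _ Ax) (F1 _ Ay))[].
  - by move=> /finj-/(_ (F1 _ Ax) (F2 _ (gA _ Cy))).
  - by move=> /finj-/(_ (F2 _ (gA _ Cx)) (F1 _ Ay)).
  - by move=> /finj-/(_ (F2 _ (gA _ Cx)) (F2 _ (gA _ Cy))) => -[*]; exact: ginj.
have code (C : set T) (k : T -> T) : (forall x, C x -> A (k x)) ->
   (forall x y, C x -> C y -> k x = k y -> x = y) ->
   (forall s, List.Forall C s -> A (f (map k s))) /\
   (forall s s', List.Forall C s -> List.Forall C s' -> f (map k s) = f (map k s') -> s = s').
  move=> kA kinj.
  have kF s : List.Forall C s -> List.Forall A (map k s).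
    by elim=> //= x l Cx _ IH; constructor=> //; exact: kA.
  split=> [s /kF/fA//|s s' Cs Cs' /finj-/(_ (kF _ Cs) (kF _ Cs'))].
  elim: Cs s' Cs' => [|x l Cx _ IH] [|x' l'] //= Cs' [kx kl].
  have [Cx' Cl'] : C x' /\ List.Forall C l' by inversion Cs'.
  by rewrite (kinj x x') // (IH l').
have [le|le] := card_le_total (~` A) A.
  have [g [gA ginj]] := card_leP_fun (d 0%N) le.
  have [|k [kA kinj]] := fold _ g gA ginj; first by rewrite setICl.
  have [cA cinj] := code _ _ kA kinj.
  have all s : List.Forall (A `|` ~` A) s by apply/List.Forall_forall => x _; rewrite setUv.
  by apply: (card_le_fun (fun s => f (map k s))) => // s s' _ _; exact: cinj.
have [h [hA hinj]] := card_leP_fun (d 0%N) le.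
pose A' := h @` A.
have A'A : A' `&` A = set0.
  by apply/seteqP; split=> // _ [[x Ax <-] Ahx]; case: (hA _ Ax).
have [g gP] : exists g, forall x, A x -> g (h x) = x.
  have ex (y : T) : exists x, forall x', A x' -> h x' = y -> x = x'.
    have [[x [Ax <-]]|nx] := pselect (exists x, A x /\ h x = y).
      by exists x => x' Ax' /esym; exact: hinj.
    by exists y => x' Ax' hx'; case: nx; exists x'.
  by have [g gP] := choice ex; exists g => x Ax; exact: gP.
have [| | |k [kA kinj]] := fold A' g.
- by move=> _ [x Ax <-]; rewrite gP.
- by move=> _ _ [x Ax <-] [y Ay <-]; rewrite !gP // => ->.
- exact: A'A.
have [cA cinj] := code _ _ kA kinj.
have Aup s : List.Forall A s -> List.Forall (A `|` A') s.
  by apply: List.Forall_impl => x; left.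
have A0 : A (f [::]) by exact/fA/List.Forall_nil.
(* The added lists get values in [A'], disjoint from the old values in [A], so injectivity survives.
   The one-entry list of [h (f [::])] shows that the extension is proper. *)
exfalso; apply: (Mmax (M `|` [set p | [/\ List.Forall (A `|` A') p.1,
    ~ List.Forall A p.1 & p.2 = h (f (map k p.1))]])).
  split=> [p Mp|]; first by left.
  have A's : List.Forall (A `|` A') [:: h (f [::])].
    by constructor => //; right; exists (f [::]).
  move=> /(_ ([:: h (f [::])], h (f (map k [:: h (f [::])])))) hM.
  have /MA[_] : M ([:: h (f [::])], h (f (map k [:: h (f [::])]))).
    apply: hM; right; split=> //= h0.
    by apply: (hA _ A0); inversion h0.
  by apply: hA; exact: cA.
right; exists (A `|` A'); split.
- move=> s y [/MA[/Aup As Ay]|[/= As nAs ->]]; split=> //; first by left.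
  by right; exists (f (map k s)) => //; exact: cA.
- move=> s As; have [/Mtot[y My]|nAs] := pselect (List.Forall A s).
    by exists y; left.
  by exists (h (f (map k s))); right.
- have nMh s s' : List.Forall (A `|` A') s' -> M (s, h (f (map k s'))) -> False.
    by move=> s'F /MA[_]; apply: hA; exact: cA.
  move=> s s' y [Ms|[/= As nAs ->]] [Ms'|[/= As' nAs' ys']].
  + exact: Minj Ms Ms'.
  + by rewrite ys' in Ms; case: (nMh _ _ As' Ms).
  + by case: (nMh _ _ As Ms').
  + by apply: cinj => //; apply: hinj ys'; exact: cA.
- move=> s y y' [Ms|[/= As nAs ->]] [Ms'|[/= As' nAs' ys']].
  + exact: Mfun Ms Ms'.
  + by case: nAs'; have [] := MA _ _ Ms.
  + by case: nAs; have [] := MA _ _ Ms'.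
  + by rewrite ys'.
Qed.

(** A pair [(x, n)] is coded by the list of n+1 copies of [x]: never empty, so that [x] can be read
    off. *)
Lemma card_setX_nat_le {T : Type} {A : set T} : infinite_set A ->
  A `*` [set: nat] #<= A.
Proof.
move=> infA; have infA' : infinite_set [set: A].
  by rewrite (eq_finite_set (card_setT A)).
have AS : [set: seq A] #<= A.
  by rewrite -(card_le_eqr (card_setT A)); exact: card_seq_le.
apply: card_le_trans _ AS.
apply: (card_le_rel (fun (p : T * nat) (s : seq A) => map set_val s = nseq p.2.+1 p.1)).
  move=> [x n] [/= Ax _]; exists (nseq n.+1 (SigSub (mem_set Ax))) => //.
  by rewrite map_nseq.
move=> [x n] [x' n'] s _ _ -> /=; move=> [-> /(congr1 size)].
by rewrite !size_nseq => ->.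
Qed.

(** * The groups 2^K *)

(** The given uniformity itself separates a point from a closed set: some entourage has a section at
    the point that avoids the set. *)
Lemma uniform_tychonoff (T : uniformType) :
  accessible_space T -> tychonoff_space T.
Proof.
move=> accT; split=> // x B clB nBx.
have : open (~` B) by rewrite openC.
rewrite openE => /(_ _ nBx); rewrite /interior /= -nbhs_entourageE => -[E entE EnB].
exists (Uniform.class T), E; split => //; last by move=> ?.
by rewrite -subset0 => -[? w [/= [-> ? /xsectionP ?]]]; exact: (EnB w).
Qed.

Definition agree {K : Type} (s : seq K) (f g : cantor_group K) :=
  List.Forall (fun k => g k = f k) s.

Lemma agree_in {K : Type} {s : seq K} {f g : cantor_group K} {k : K} :
  agree s f g -> List.In k s -> g k = f k.
Proof. by move/List.Forall_forall => h /h. Qed.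

(** The sets containing some [agree s f] form a filter. It converges to [f], as is checked one
    coordinate at a time with one-entry lists. *)
Lemma cantor_nbhsP {K : Type} (f : cantor_group K) (V : set (cantor_group K)) :
  nbhs f V <-> exists s : seq K, agree s f `<=` V.
Proof.
split.
  pose F : set_system (cantor_group K) := [set V | exists s : seq K, agree s f `<=` V].
  have FF : Filter F.
    split; first by exists [::].
    - move=> P Q [s sP] [t tQ]; exists (s ++ t) => g /List.Forall_app[sg tg].
      by split; [exact: sP|exact: tQ].
    - by move=> P Q PQ [s sP]; exists s => g /sP/PQ.
  suff : F --> f by apply.
  apply/cvg_sup => k U [_ [[W oW <-] /= Wf WU]].
  exists [:: k] => g /agree_in-/(_ _ (or_introl erefl)) gk.
  by apply: WU; rewrite /= gk.
move=> [s sV]; apply: filterS sV _.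
elim: s => [|k s IH]; first by apply: filterS filterT => g _; constructor.
have : nbhs f [set g : cantor_group K | g k = f k].
  have := @proj_continuous {classic K} (fun=> bool) k f [set b | b = f k].
  by apply; apply/principal_filterP.
move=> /filterI/(_ IH); apply: filterS => g [gk gs].
exact: List.Forall_cons.
Qed.

Lemma open_agree {K : Type} (s : seq K) (f : cantor_group K) : open (agree s f).
Proof.
rewrite openE => g fg; apply/cantor_nbhsP; exists s => h gh.
apply/List.Forall_forall => k ks.
by rewrite (agree_in gh ks) (agree_in fg ks).
Qed.

Lemma cantor_addE {K : Type} (f g : cantor_group K) k :
  cantor_add f g k = xorb (f k) (g k).
Proof. by []. Qed.

Lemma cantor_add_cont (K : Type) :
  continuous (fun p : cantor_group K * cantor_group K => cantor_add p.1 p.2).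
Proof.
move=> [f g] V /cantor_nbhsP[s sV].
exists (agree s f, agree s g) => /=.
  by split; apply/cantor_nbhsP; exists s.
move=> [f' g'] [/= ff' gg']; apply: sV; apply/List.Forall_forall => k ks.
by rewrite !cantor_addE (agree_in ff' ks) (agree_in gg' ks).
Qed.

Lemma cantor_accessible (K : Type) : accessible_space (cantor_group K).
Proof.
move=> f g /eqP fg; have [k fgk] : exists k, f k <> g k.
  by apply/existsNP => h; apply: fg; apply: funext => k; exact: h.
exists (agree [:: k] f); split; first exact: open_agree.
  by apply/mem_set; constructor.
by apply/mem_set => /= h; inversion h; apply: fgk.
Qed.

(** The inverse is [id], every element being its own opposite modulo 2. *)
Definition cantor_topGroup (K : Type) : topGroup :=
  @TopGroup (cantor_group K) (@cantor_add K) id (@cantor_zero K)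
    (fun x y z => funext (fun k => esym (Bool.xorb_assoc (x k) (y k) (z k))))
    (fun x => funext (fun k => Bool.xorb_false_l (x k)))
    (fun x => funext (fun k => Bool.xorb_nilpotent (x k)))
    (@cantor_add_cont K) (fun x => cvg_id)
    (uniform_tychonoff _ (@cantor_accessible K)).

Lemma cantor_addKK {K : Type} (f g : cantor_group K) :
  cantor_add f (cantor_add f g) = g.
Proof. by apply: funext => k; rewrite !cantor_addE; case: (f k); case: (g k). Qed.

Lemma cantor_ltrans {K : Type} {s : seq K} {V : set (cantor_group K)}
    {f g : cantor_group K} :
  agree s (@cantor_zero K) `<=` V -> agree s f g -> ltrans (@cantor_add K) f V g.
Proof.
move=> sV fg; exists (cantor_add f g); last exact: cantor_addKK.
apply: sV; apply/List.Forall_forall => k ks.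
by rewrite cantor_addE (agree_in fg ks) Bool.xorb_nilpotent.
Qed.

Lemma cantor_aleph0_bounded (K : Type) : aleph0_bounded (cantor_topGroup K).
Proof.
move=> U [oU U0]; have /cantor_nbhsP[s sU] : nbhs (@cantor_zero K) U.
  exact: open_nbhs_nbhs.
pose s' : seq {classic K} := s.
(* The number [n] is decoded as a list of bits, placed along [s]; the bits of [g] on [s] then give
   the translate that contains [g]. *)
exists (fun n k => nth false (odflt [::] (unpickle n)) (index (k : {classic K}) s')).
move=> g _; exists (pickle (map g s')) => //.
apply: cantor_ltrans sU _; apply/List.Forall_forall => k ks.
have ks' : (k : {classic K}) \in s'.
  by move: ks; rewrite /s'; elim: (s) => //= x l IH [->|/IH]; rewrite inE ?eqxx // => ->; rewrite orbT.
by rewrite pickleK /= (nth_map (k : {classic K})) ?index_mem // nth_index.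
Qed.

(** A cylinder is given by two lists, the coordinates set to true and those set to false. A pair of
    lists is a list of lists, so [card_seq_le] is applied twice. *)
Lemma cantor_base_le {K : Type} : infinite_set [set: K] ->
  exists2 B : set (set (cantor_group K)), is_base B & B #<= [set: K].
Proof.
move=> infK; have [d [_ dinj]] := infinite_inj_nat infK.
pose cyl (p : seq K * seq K) : set (cantor_group K) :=
  [set f | (forall k, List.In k p.1 -> f k = true) /\
           (forall k, List.In k p.2 -> f k = false)].
exists (range cyl).
  split=> [_ [p _ <-]|U oU f Uf].
    rewrite openE => f [f1 f2]; apply/cantor_nbhsP; exists (p.1 ++ p.2) => g.
    move=> /List.Forall_app[/List.Forall_forall g1 /List.Forall_forall g2].
    by split=> k kp; [rewrite g1 // f1|rewrite g2 // f2].
  have /cantor_nbhsP[s sU] : nbhs f U by exact: open_nbhs_nbhs.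
  exists (cyl (List.filter f s, List.filter (fun k => ~~ f k) s)).
    by eexists.
  split=> [|g [g1 g2]].
    by split=> k /List.filter_In[_] //; case: (f k).
  apply: sU; apply/List.Forall_forall => k ks.
  case fk : (f k); [apply: g1|apply: g2]; apply/List.filter_In; split=> //.
  by rewrite fk.
have infS : infinite_set [set: seq K].
  apply/infiniteP/(card_le_fun (fun n => [:: d n])) => // m n _ _ [/dinj].
  exact.
apply: card_le_trans (card_image_le _ _) _.
apply: card_le_trans _ (card_seq_le _ infK).
apply: card_le_trans _ (card_seq_le _ infS).
apply: (card_le_fun (fun p => [:: p.1; p.2])) => //.
by move=> [a b] [a' b'] _ _ [-> ->].
Qed.

(** Choose for each [k] a base set around the point [one] that forces coordinate [k] to be true. An
    open set around [one] forces only finitely many coordinates, so the choice is finite-to-one. *)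
Lemma cantor_base_ge {K : Type} (B : set (set (cantor_group K))) :
  infinite_set [set: K] -> is_base B -> [set: K] #<= B.
Proof.
move=> infK [oB baseB].
pose one : cantor_group K := fun=> true.
pose hyp k (V : set (cantor_group K)) := forall f, V f -> f k = true.
have [V VP] : exists V : K -> set (cantor_group K), forall k,
    [/\ B (V k), V k one & hyp k (V k)].
  suff /choice[V VP] : forall k, exists W, [/\ B W, W one & hyp k W] by exists V.
  move=> k.
  have [|V BV [V1 Vk]] := baseB (agree [:: k] one) (open_agree _ _) one.
    by constructor.
  exists V; split=> // f /Vk h.
  exact: (agree_in h (or_introl erefl)).
have [s sP] : exists s : set (cantor_group K) -> seq K,
    forall W, B W -> W one -> forall k, hyp k W -> List.In k (s W).
  suff /choice[s sP] : forall W, exists s, B W -> W one -> forall k, hyp k W -> List.In k s.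
    by exists s.
  move=> W.
  have [[BW W1]|h] := pselect (B W /\ W one); last first.
    by exists [::] => BW W1; case: h.
  have /cantor_nbhsP[s sW] : nbhs one W by apply: open_nbhs_nbhs; split=> //; exact: oB.
  exists s => _ _ k hk; apply: contrapT => nks.
  (* Flipping coordinate [k] alone stays inside [W] when [k] is not in [s]. *)
  pose f : cantor_group K := fun k' => ~~ `[< k' = k >].
  have /sW/hk : agree s one f.
    apply/List.Forall_forall => k' k's; rewrite /f; case: asboolP => // k'k.
    by case: nks; rewrite -k'k.
  by rewrite /f; case: asboolP.
have infB : infinite_set B.
  move=> finB; apply: infK.
  apply: (@sub_finite_set _ _ (\bigcup_(W in B) [set k | List.In k (s W)])).
    by move=> k _; exists (V k); have [] := VP k => // ? ? ?; exact: sP.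
  apply: bigcup_finite => // W _; elim: (s W) => [|x l IH].
    by rewrite (_ : [set _ | _] = set0).
  apply: (@sub_finite_set _ _ ([set x] `|` [set k | List.In k l])).
    by move=> k [->|]; [left|right].
  by rewrite finite_setU; split.
apply: (card_le_trans _ (card_setX_nat_le infB)).
apply: (card_le_rel (fun k p => p.1 = V k /\ List.nth_error (s (V k)) p.2 = Some k)).
  move=> k _; have [BV V1 Vk] := VP k.
  by have [n sn] := List.In_nth_error _ _ (sP _ BV V1 _ Vk); exists (V k, n).
by move=> k k' [W n] _ _ [/= -> kn] [Vkk']; rewrite -Vkk' kn => -[].
Qed.

(** [Lam] may live in another type: this serves when a subset is turned into the index type of the
    group. *)
Lemma cantor_weight {K L : Type} {Lam : set L} :
  infinite_set [set: K] -> Lam #= [set: K] -> has_weight (cantor_topGroup K) Lam.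
Proof.
move=> infK LamK; split.
  have [B baseB BK] := cantor_base_le infK; exists B => //.
  rewrite (card_eqr LamK); apply/Cantor_Bernstein => //.
  exact: cantor_base_ge.
move=> B baseB; rewrite (card_le_eql LamK); exact: cantor_base_ge.
Qed.

Lemma BC_card_cantor (K : Type) : infinite_set [set: K] ->
  BC_card [set: K] -> BC_cantor K.
Proof.
move=> infK BC X rbX.
apply: (BC (cantor_topGroup K)) => //; first exact: cantor_aleph0_bounded.
exact: cantor_weight.
Qed.

(** * Kurepa families *)

(** The trace of [X] along [j] as a point of 2^J. Below, [j] is the identity or the inclusion of a
    subset. *)
Definition char {K J : Type} (j : J -> K) (X : set K) : cantor_group J :=
  fun i => `[< X (j i) >].

Lemma char_eq {K J : Type} {j : J -> K} {X Y : set K} :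
  char j X = char j Y -> forall i, X (j i) <-> Y (j i).
Proof.
move=> XY i; have := congr1 (@^~ i) XY; rewrite /char => e.
by split=> h; apply/asboolP; [rewrite -e|rewrite e]; apply/asboolP.
Qed.

Lemma kurepa_rothberger {K J : Type} (j : J -> K) (F : set (set K)) :
  ~ countable [set: K] -> kurepa_family (fun A : set K => countable A) F ->
  rothberger_bounded (@cantor_add J) (@cantor_zero J) (char j @` F).
Proof.
move=> uncK [_ kurF] U nbU.
have infK : infinite_set [set: K] by move=> /finite_set_countable.
have [d [_ dinj]] := infinite_inj_nat infK.
have [s sU] : exists s : nat -> seq J,
    forall n, agree (s n) (@cantor_zero J) `<=` U n.
  suff /choice[s sU] : forall n, exists s, agree s (@cantor_zero J) `<=` U n.
    by exists s.
  by move=> n; apply/cantor_nbhsP; apply: open_nbhs_nbhs; exact: nbU.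
(* Adding [range d] makes [A] infinite, as the Kurepa condition demands. *)
pose A := range d `|` \bigcup_n [set k | List.In k (List.map j (s n))].
have ctA : countable A.
  have ctU (P Q : set K) : countable P -> countable Q -> countable (P `|` Q).
    move=> ctP ctQ; rewrite -bigcup2E; apply: bigcup_countable => //.
    by move=> [|[|n]] _ //=; exact: countable0.
  apply: ctU; first exact: card_image_le.
  apply: bigcup_countable => // n _; apply: finite_set_countable.
  elim: (s n) => [|x l IH] /=; first by rewrite (_ : [set _ | _] = set0).
  apply: (@sub_finite_set _ _ ([set j x] `|` [set k | List.In k (List.map j l)])).
    by move=> k [->|]; [left|right].
  by rewrite finite_setU; split.
have infA : infinite_set A.
  by apply/infiniteP/(card_le_fun d) => [n _|m n _ _ /dinj//]; left; exists n.
have ctT : [set X `&` A | X in F] #<= [set: nat] := card_le_trans (kurF A infA ctA) ctA.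
have [F0|/set0P[X0 FX0]] := eqVneq F set0.
  by exists (fun _ => @cantor_zero J); rewrite F0 => f [X []].
have [c [_ cinj]] := card_leP_fun 0%N ctT.
have [X XP] : exists X : nat -> set K, forall Y, F Y ->
    X (c (Y `&` A)) `&` A = Y `&` A.
  suff /choice[X XP] : forall n, exists X, forall Y, F Y -> c (Y `&` A) = n ->
      X `&` A = Y `&` A by exists X => Y FY; exact: XP.
  move=> n; have [[X [FX cX]]|nX] := pselect (exists X, F X /\ c (X `&` A) = n).
    exists X => Y FY cY; apply: cinj; [by exists X|by exists Y|by rewrite cX cY].
  by exists set0 => Y FY cY; case: nX; exists Y.
exists (fun n => char j (X n)) => _ [Y FY <-].
exists (c (Y `&` A)) => //; apply: (cantor_ltrans (sU _)).
apply/List.Forall_forall => i i_s; rewrite /char.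
have Aji : A (j i) by right; exists (c (Y `&` A)) => //; exact: List.in_map i_s.
apply/asboolP/asboolP => h.
  by have [] : (X (c (Y `&` A)) `&` A) (j i) by rewrite XP.
by have [] : (Y `&` A) (j i) by rewrite -XP.
Qed.

Lemma BC_cantor_not_KH_aleph1 (K : Type) : ~ countable [set: K] ->
  BC_cantor K -> ~ KH_aleph1 K.
Proof.
move=> uncK BC [F kurF]; have [[_ nFK] _] := kurF; apply: nFK.
apply: card_le_trans (BC _ (kurepa_rothberger id F uncK kurF)).
apply: (card_le_fun (char id)) => [X FX|X Y _ _ XY]; first by exists X.
by apply/seteqP; split=> k; case: (char_eq XY k).
Qed.

Lemma countable_card_lt {K : Type} {A : set K} : ~ countable [set: K] ->
  countable A -> card_lt A [set: K].
Proof.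
move=> uncK ctA; split; first exact: card_leT.
by move=> KA; apply: uncK; exact: card_le_trans KA ctA.
Qed.

Lemma KH_kappa_KH_aleph1 (K : Type) : ~ countable [set: K] ->
  KH_kappa K -> KH_aleph1 K.
Proof.
move=> uncK [F [cardF kurF]]; exists F; split=> // A infA ctA.
by apply: kurF => //; exact: countable_card_lt.
Qed.

(** The same family serves: a trace on [A] amounts to a point of 2^A, with [A] viewed as a type. *)
Lemma KH_aleph1_KH_kappa (K : Type) : ~ countable [set: K] ->
  (forall Lam : set K, infinite_set Lam -> card_lt Lam [set: K] -> BC_card Lam) ->
  KH_aleph1 K -> KH_kappa K.
Proof.
move=> uncK BC [F kurF]; exists F; split; first by have [] := kurF.
move=> A infA ltA.
have infA' : infinite_set [set: A].
  by rewrite (eq_finite_set (card_setT A)).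
have AA : A #= [set: A] by rewrite card_eq_sym; exact: card_setT.
have := BC A infA ltA (cantor_topGroup A) (cantor_aleph0_bounded A)
  (cantor_weight infA' AA) _ (kurepa_rothberger (set_val : A -> K) F uncK kurF).
apply: card_le_trans.
apply: (card_le_rel (fun T f => exists X, [/\ F X, T = X `&` A & f = char (set_val : A -> K) X])).
  by move=> _ [X FX <-]; exists (char set_val X); exists X.
move=> T T' f _ _ [X [FX -> ->]] [X' [FX' -> XX']].
apply/seteqP; split=> k [Xk Ak]; split=> //.
  by apply/(char_eq XX' (SigSub (mem_set Ak))).
by apply/(char_eq XX' (SigSub (mem_set Ak))).
Qed.

(** * Transfer of Borel-type statements between cardinals *)

Lemma BC_card_eq {L M : Type} {Lam : set L} {Mu : set M} :
  Lam #= Mu -> BC_card Lam -> BC_card Mu.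
Proof.
move=> LM BC G bG [[B baseB BMu] leMu] X rbX.
rewrite -(card_le_eqr LM); apply: (BC G) => //; split.
  by exists B => //; rewrite (card_eqr LM).
by move=> B' baseB'; rewrite (card_le_eql LM); exact: leMu.
Qed.

(** A countably infinite subset of [K] represents the cardinal aleph_0, which lies below that of
    [K]. *)
Lemma BC_below_BorelConjecture (K : Type) : ~ countable [set: K] ->
  (forall Lam : set K, infinite_set Lam -> card_lt Lam [set: K] -> BC_card Lam) ->
  BorelConjecture.
Proof.
move=> uncK BC; have infK : infinite_set [set: K] by move=> /finite_set_countable.
have [d [_ dinj]] := infinite_inj_nat infK.
have dN : range d #= [set: nat] by apply: inj_card_eq => m n _ _; exact: dinj.
apply: (BC_card_eq dN); apply: BC.
  by rewrite (eq_finite_set dN); exact: infinite_nat.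
by apply: countable_card_lt => //; exact: card_image_le.
Qed.

(** * Chains of neighbourhoods of the identity *)

Section TopGroupTheory.
Variable G : topGroup.
Local Notation "x ** y" := (@tg_mul G x y) (at level 40, left associativity).
Local Notation inv := (@tg_inv G).
Local Notation one := (tg_one G).
Implicit Types x y z : G.

Lemma tg_mulKg x y : inv x ** (x ** y) = y.
Proof. by rewrite tg_mulA tg_mulVg tg_mul1g. Qed.

Lemma tg_mulgV x : x ** inv x = one.
Proof. by rewrite -[LHS](tg_mulKg (inv x)) (tg_mulKg x) tg_mulVg. Qed.

Lemma tg_mulVKg x y : x ** (inv x ** y) = y.
Proof. by rewrite tg_mulA tg_mulgV tg_mul1g. Qed.

Lemma tg_mulg1 x : x ** one = x.
Proof. by rewrite -(tg_mulVg x) tg_mulVKg. Qed.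

Lemma tg_invP x y : x ** y = one -> y = inv x.
Proof. by move=> xy; rewrite -(tg_mulKg x y) xy tg_mulg1. Qed.

Lemma tg_invgK x : inv (inv x) = x.
Proof. by apply/esym/tg_invP; rewrite tg_mulVg. Qed.

Lemma tg_invMg x y : inv (x ** y) = inv y ** inv x.
Proof. by apply/esym/tg_invP; rewrite -tg_mulA tg_mulVKg tg_mulgV. Qed.

Lemma tg_inv1 : inv one = one.
Proof. by apply/esym/tg_invP; rewrite tg_mul1g. Qed.

Lemma tg_mul_nbhs x y (U : set G) : nbhs (x ** y) U ->
  exists2 P, nbhs x P & exists2 Q, nbhs y Q & forall a b, P a -> Q b -> U (a ** b).
Proof.
move=> /(@tg_mul_cont G (x, y))[[P Q] [/= Px Qy] PQ].
by exists P => //; exists Q => // a b Pa Qb; exact: (PQ (a, b)).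
Qed.

Lemma tg_div_nbhs (U : set G) : nbhs one U ->
  exists2 V, nbhs one V & forall a b, V a -> V b -> U (inv a ** b).
Proof.
rewrite -{1}(tg_mul1g one) -{1}tg_inv1 => /tg_mul_nbhs[P P1 [Q Q1 PQ]].
exists ((inv @^-1` P) `&` Q); last by move=> a b [Pa _] [_ Qb]; exact: PQ.
by apply: filterI => //; exact: tg_inv_cont P1.
Qed.

Lemma tg_conj_nbhs (U : set G) : nbhs one U ->
  exists2 V, nbhs one V & forall a b, V a -> V b -> U (inv b ** (a ** b)).
Proof.
rewrite -{1}(tg_mul1g one) -{1}tg_inv1 => /tg_mul_nbhs[P P1 [Q Q1 PQ]].
move: Q1; rewrite -{1}(tg_mul1g one) => /tg_mul_nbhs[R R1 [S S1 RS]].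
exists ((inv @^-1` P) `&` (R `&` S)).
  by apply: filterI; [exact: tg_inv_cont P1|exact: filterI].
by move=> a b [_ [Ra _]] [Pb [_ Sb]]; apply: PQ => //; exact: RS.
Qed.

Lemma tg_conj_nbhs1 g (U : set G) : nbhs one U ->
  nbhs one [set x | U (inv g ** (x ** g))].
Proof.
move=> U1; have : nbhs (inv g ** (one ** g)) U by rewrite tg_mul1g tg_mulVg.
move=> /tg_mul_nbhs[P Pg [Q /tg_mul_nbhs[R R1 [S Sg RS]] PQ]].
apply: filterS R1 => x Rx /=; apply: PQ; first exact: nbhs_singleton.
by apply: RS => //; exact: nbhs_singleton.
Qed.

Lemma aleph0_bounded_nbhs (U : set G) : aleph0_bounded G -> nbhs one U ->
  exists g : nat -> G, forall x, exists k, U (inv (g k) ** x).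
Proof.
move=> bG U1; have [|g gP] := bG U°.
  by split; first exact: open_interior.
exists g => x; have [k _ [u Uu <-]] := gP x I.
by exists k; rewrite tg_mulKg; exact: interior_subset.
Qed.

(** Each group element is some [g k] times an element of [V], and conjugation by elements of [V]
    sends [V] into [U]. Hence countably many conjugates of [V] suffice for all [g]. *)
Lemma aleph0_bounded_conj (U : set G) : aleph0_bounded G -> nbhs one U ->
  exists T : nat -> set G, (forall k, nbhs one (T k)) /\
    forall g, exists k, forall x, T k x -> U (inv g ** (x ** g)).
Proof.
move=> bG /tg_conj_nbhs[V V1 VU].
have [g gP] := aleph0_bounded_nbhs V bG V1.
exists (fun k => [set x | V (inv (g k) ** (x ** g k))]).
split=> [k|h]; first exact: tg_conj_nbhs1.
have [k Vk] := gP h; exists k => x /= Vx.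
have := VU _ _ Vx Vk; rewrite tg_invMg tg_invgK -!tg_mulA.
by rewrite !tg_mulVKg.
Qed.

(** The last two fields make the intersection N of the chain a normal subgroup, and the images of
    the chain a countable neighbourhood base at the identity for a group topology on G/N. *)
Record nbhs_chain := NbhsChain {
  chain :> nat -> set G;
  chain_nbhs : forall n, nbhs one (chain n);
  chain_dec : forall m n x, (m <= n)%N -> chain n x -> chain m x;
  chain_div : forall n, exists m, forall x y,
    chain m x -> chain m y -> chain n (inv x ** y);
  chain_conj : forall n g, exists m, forall x,
    chain m x -> chain n (inv g ** (x ** g)) }.

Lemma nbhs_finI (P : nat -> set G) : (forall i, nbhs one (P i)) ->
  forall n, nbhs one [set x | forall i, (i <= n)%N -> P i x].
Proof.
move=> P1; elim=> [|n IH].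
  by apply: filterS (P1 0%N) => x Px [].
apply: filterS (filterI IH (P1 n.+1)) => x [Hx Px] i.
by rewrite leq_eqVlt ltnS => /predU1P[->//|]; exact: Hx.
Qed.

Lemma ex_uniform_bound (Q : nat -> nat -> Prop) :
  (forall i m m', (m <= m')%N -> Q i m -> Q i m') ->
  (forall i, exists m, Q i m) ->
  forall n, exists m, forall i, (i <= n)%N -> Q i m.
Proof.
move=> Qmono Qex; elim=> [|n [m mP]].
  by have [m Qm] := Qex 0%N; exists m => -[].
have [m' Qm'] := Qex n.+1; exists (maxn m m') => i.
rewrite leq_eqVlt ltnS => /predU1P[->|/mP Qi].
  exact: Qmono (leq_maxr _ _) Qm'.
exact: Qmono (leq_maxl _ _) Qi.
Qed.

(* Close [W] under the unary operations [half] and [conj _ k], so that the closure is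
   indexed by words, and take the finite intersections of an enumeration. *)
Lemma ex_nbhs_chain (W : nat -> set G) : aleph0_bounded G ->
  (forall n, nbhs one (W n)) ->
  exists E : nbhs_chain, forall x, (forall n, E n x) -> forall n, W n x.
Proof.
move=> bG W1.
have /choice[half halfP] (U : set G) : exists V, nbhs one U ->
    nbhs one V /\ forall a b, V a -> V b -> U (inv a ** b).
  have [/tg_div_nbhs[V V1 VU]|] := pselect (nbhs one U); first by exists V.
  by exists set0.
have /choice[conj conjP] (U : set G) : exists T : nat -> set G, nbhs one U ->
    (forall k, nbhs one (T k)) /\
    forall g, exists k, forall x, T k x -> U (inv g ** (x ** g)).
  have [/(aleph0_bounded_conj _ bG)[T TP]|] := pselect (nbhs one U).
    by exists T.
  by exists (fun=> set0).
(* The letter 0 stands for [half], the letter k+1 for the k-th conjugation set. *)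
pose F (p : nat * seq nat) : set G :=
  foldr (fun k U => if k is k'.+1 then conj U k' else half U) (W p.1) p.2.
have F1 p : nbhs one (F p).
  case: p => n s; rewrite /F /=; elim: s => //= -[|k] s IH.
    by case: (halfP _ IH).
  by case: (conjP _ IH).
pose dec i : nat * seq nat := odflt (0%N, [::]) (unpickle i).
pose E n : set G := [set x | forall i, (i <= n)%N -> F (dec i) x].
have EF p x : E (pickle p) x -> F p x.
  by move=> /(_ _ (leqnn _)); rewrite /dec pickleK.
have Edec m n x : (m <= n)%N -> E n x -> E m x.
  by move=> mn Ex i im; apply: Ex; exact: leq_trans im mn.
have Ediv n : exists m, forall x y, E m x -> E m y -> E n (inv x ** y).
  have [|i|m mP] := ex_uniform_bound
      (fun i m => forall x y, E m x -> E m y -> F (dec i) (inv x ** y)) _ _ n.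
  - by move=> i m m' mm' Q x y /(Edec _ _ _ mm')Ex /(Edec _ _ _ mm'); exact: Q.
  - case: (dec i) => k s; exists (pickle (k, 0%N :: s)) => x y /EF Fx /EF Fy.
    by have [_] := halfP _ (F1 (k, s)); exact.
  - by exists m => x y Ex Ey i /mP; exact.
have Econj n g : exists m, forall x, E m x -> E n (inv g ** (x ** g)).
  have [|i|m mP] := ex_uniform_bound
      (fun i m => forall x, E m x -> F (dec i) (inv g ** (x ** g))) _ _ n.
  - by move=> i m m' mm' Q x /(Edec _ _ _ mm'); exact: Q.
  - case: (dec i) => k s; have [_ /(_ g)[j jP]] := conjP _ (F1 (k, s)).
    by exists (pickle (k, j.+1 :: s)) => x /EF; exact: jP.
  - by exists m => x Ex i /mP; exact.
exists (NbhsChain E (nbhs_finI _ (fun i => F1 (dec i))) Edec Ediv Econj) => x Ex n.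
by have := EF (n, [::]) x (Ex _).
Qed.

End TopGroupTheory.

(** * The quotient by a chain of neighbourhoods *)

Section ChainQuotient.
Variables (G : topGroup) (E : nbhs_chain G).
Local Notation "x ** y" := (@tg_mul G x y) (at level 40, left associativity).
Local Notation inv := (@tg_inv G).
Local Notation one := (tg_one G).
Implicit Types x y z : G.

Lemma chain1 n : E n one.
Proof. by apply: nbhs_singleton; exact: chain_nbhs. Qed.

Lemma chain_inv n : exists m, forall x, E m x -> E n (inv x).
Proof.
have [m mP] := chain_div _ E n; exists m => x Ex.
by rewrite -(tg_mulg1 _ (inv x)); apply: mP => //; exact: chain1.
Qed.

Lemma chain_mul n : exists m, forall x y, E m x -> E m y -> E n (x ** y).
Proof.
have [m mP] := chain_div _ E n; have [p pP] := chain_inv m.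
exists (maxn m p) => x y Ex Ey; rewrite -(tg_invgK _ x); apply: mP.
  by apply: pP; apply: chain_dec Ex; exact: leq_maxr.
by apply: chain_dec Ey; exact: leq_maxl.
Qed.

Lemma chain_mul3 n : exists m, forall x y z,
  E m x -> E m y -> E m z -> E n (x ** y ** z).
Proof.
have [m mP] := chain_mul n; have [p pP] := chain_mul m.
exists (maxn m p) => x y z Ex Ey Ez; apply: mP.
  by apply: pP; [apply: chain_dec Ex|apply: chain_dec Ey]; exact: leq_maxr.
by apply: chain_dec Ez; exact: leq_maxl.
Qed.

Definition chain_rel x y := forall n, E n (inv x ** y).

Lemma chain_rel_refl x : chain_rel x x.
Proof. by move=> n; rewrite tg_mulVg; exact: chain1. Qed.

Lemma chain_rel_sym x y : chain_rel x y -> chain_rel y x.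
Proof.
move=> xy n; have [m mP] := chain_inv n; have := mP _ (xy m).
by rewrite tg_invMg tg_invgK.
Qed.

Lemma chain_rel_trans x y z : chain_rel x y -> chain_rel y z -> chain_rel x z.
Proof.
move=> xy yz n; have [m mP] := chain_mul n; have := mP _ _ (xy m) (yz m).
by rewrite -tg_mulA tg_mulVKg.
Qed.

(** The quotient of the two products is the conjugate by [y] of [inv x ** x'], times
    [inv y ** y']. *)
Lemma chain_rel_mul x x' y y' :
  chain_rel x x' -> chain_rel y y' -> chain_rel (x ** y) (x' ** y').
Proof.
move=> xx yy n; have [m mP] := chain_mul n; have [p pP] := chain_conj _ E m y.
have := mP _ _ (pP _ (xx p)) (yy m).
by rewrite tg_invMg -!tg_mulA tg_mulVKg.
Qed.

Lemma chain_rel_inv x y : chain_rel x y -> chain_rel (inv x) (inv y).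
Proof.
move=> /chain_rel_sym yx n; have [p pP] := chain_conj _ E n (inv x).
have := pP _ (yx p).
by rewrite tg_invgK -!tg_mulA tg_mulgV tg_mulg1.
Qed.

Definition chain_repr x := xget one [set y | chain_rel x y].

Lemma chain_reprP x : chain_rel x (chain_repr x).
Proof. by rewrite /chain_repr; case: xgetP => // /(_ x); case; exact: chain_rel_refl. Qed.

Lemma chain_repr_eq x y : chain_rel x y -> chain_repr x = chain_repr y.
Proof.
move=> xy; congr xget; apply/seteqP; split=> z; last exact: chain_rel_trans.
by apply: chain_rel_trans; exact: chain_rel_sym.
Qed.

(** Cosets of N are replaced by chosen representatives, so that equality of cosets is plain
    equality. *)
Definition quot := {x : G | chain_repr x == x}.
HB.instance Definition _ := Choice.on quot.

Definition qpi x : quot.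
Proof. by exists (chain_repr x); apply/eqP/esym/chain_repr_eq/chain_reprP. Defined.

Lemma qpi_eq x y : qpi x = qpi y <-> chain_rel x y.
Proof.
split=> [/(congr1 val) /= xy|/chain_repr_eq xy]; last exact: val_inj.
apply: chain_rel_trans (chain_reprP x) _; rewrite xy.
exact/chain_rel_sym/chain_reprP.
Qed.

Lemma qpiK (u : quot) : qpi (val u) = u.
Proof. by apply: val_inj => /=; apply/eqP; exact: (valP u). Qed.

Lemma quotW (P : quot -> Prop) : (forall x, P (qpi x)) -> forall u, P u.
Proof. by move=> H u; rewrite -(qpiK u). Qed.

Definition qmul (u v : quot) := qpi (val u ** val v).
Definition qinv (u : quot) := qpi (inv (val u)).

Lemma qmulE x y : qmul (qpi x) (qpi y) = qpi (x ** y).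
Proof. by apply/qpi_eq/chain_rel_sym/chain_rel_mul; exact: chain_reprP. Qed.

Lemma qinvE x : qinv (qpi x) = qpi (inv x).
Proof. by apply/qpi_eq/chain_rel_sym/chain_rel_inv; exact: chain_reprP. Qed.

Lemma qmulA u v w : qmul u (qmul v w) = qmul (qmul u v) w.
Proof.
by elim/quotW: u; elim/quotW: v; elim/quotW: w => *; rewrite !qmulE tg_mulA.
Qed.

Lemma qmul1g u : qmul (qpi one) u = u.
Proof. by elim/quotW: u => *; rewrite !qmulE tg_mul1g. Qed.

Lemma qmulVg u : qmul (qinv u) u = qpi one.
Proof. by elim/quotW: u => *; rewrite qinvE qmulE tg_mulVg. Qed.

Definition qball n : set (quot * quot) :=
  [set p | exists x y, [/\ p.1 = qpi x, p.2 = qpi y & E n (inv x ** y)]].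

(** Changing representatives multiplies by elements of N on both sides, which a threefold product in
    a smaller [E m] absorbs. *)
Lemma qballP n : exists m, forall x y, qball m (qpi x, qpi y) -> E n (inv x ** y).
Proof.
have [m mP] := chain_mul3 n; exists m => x y [x' [y' [/qpi_eq xx /qpi_eq yy E']]].
have := mP _ _ _ (xx m) E' (chain_rel_sym _ _ yy m).
by rewrite -!tg_mulA !tg_mulVKg.
Qed.

Definition qent : set_system (quot * quot) := [set A | exists n, qball n `<=` A].

Lemma qball_dec m n : (m <= n)%N -> qball n `<=` qball m.
Proof.
move=> mn p [x [y [px py Exy]]]; exists x, y; split=> //.
exact: chain_dec Exy.
Qed.

Lemma qent_filter : Filter qent.
Proof.
split; first by exists 0%N.
- move=> A B [m mA] [n nB]; exists (maxn m n) => p pmn; split.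
    by apply: mA; apply: qball_dec pmn; exact: leq_maxl.
  by apply: nB; apply: qball_dec pmn; exact: leq_maxr.
- by move=> A B AB [n nA]; exists n; exact: subset_trans nA AB.
Qed.

Lemma qent_diagonal A : qent A -> diagonal `<=` A.
Proof.
move=> [n nA] [u v] uv; have <- : u = v := uv; apply: nA; exists (val u), (val u).
by rewrite /= qpiK; split=> //; exact: chain_rel_refl.
Qed.

Lemma qent_inv A : qent A -> qent A^-1%relation.
Proof.
move=> [n nA]; have [m mP] := chain_inv n; exists m => -[u v] /=.
move=> [x [y [/= -> -> Exy]]]; apply: nA; exists y, x; split=> //.
by have := mP _ Exy; rewrite tg_invMg tg_invgK.
Qed.

Lemma qent_split A : qent A -> exists2 B, qent B & (B \; B)%relation `<=` A.
Proof.
move=> [n nA]; have [p pP] := chain_mul n; have [m mP] := qballP p.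
exists (qball m); first by exists m.
move=> [u w] [v /= uv vw]; move: uv vw; elim/quotW: u; elim/quotW: v; elim/quotW: w.
move=> z y x /mP xy /mP yz; apply: nA; exists x, z; split=> //.
by have := pP _ _ xy yz; rewrite -tg_mulA tg_mulVKg.
Qed.

HB.instance Definition _ :=
  isUniform.Build quot qent_filter qent_diagonal qent_inv qent_split.

Lemma quot_nbhsP x (V : set quot) : nbhs (qpi x) V <->
  exists n, forall y, E n (inv x ** y) -> V (qpi y).
Proof.
rewrite -nbhs_entourageE; split=> [[A [n nA] AV]|[n nV]].
  exists n => y Exy; apply: AV; apply/xsectionP; apply: nA.
  by exists x, y.
have [m mP] := qballP n; exists (qball m); first by exists m.
by elim/quotW => y /xsectionP /mP; exact: nV.
Qed.

(** [x ** a ** (y ** b)] differs from [x ** y] by the conjugate of [a] by [y], times [b]. *)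
Lemma qmul_cont : continuous (fun p : quot * quot => qmul p.1 p.2).
Proof.
move=> [u v]; elim/quotW: u; elim/quotW: v => y x V; rewrite /= qmulE.
move=> /quot_nbhsP[n nV]; have [m mP] := chain_mul n.
have [p pP] := chain_conj _ E m y.
exists ([set u | exists2 a, u = qpi (x ** a) & E p a],
        [set v | exists2 b, v = qpi (y ** b) & E m b]) => /=.
  split; apply/quot_nbhsP; [exists p|exists m] => z Ez.
    by exists (inv x ** z) => //; rewrite tg_mulVKg.
  by exists (inv y ** z) => //; rewrite tg_mulVKg.
move=> [_ _] [/= [a -> Ea] [b -> Eb]]; rewrite qmulE; apply: nV.
have := mP _ _ (pP _ Ea) Eb.
by rewrite tg_invMg -!tg_mulA tg_mulKg.
Qed.

Lemma qinv_cont : continuous qinv.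
Proof.
move=> u; elim/quotW: u => x V; rewrite qinvE => /quot_nbhsP[n nV].
have [m mP] := chain_conj _ E n (inv x); have [p pP] := chain_inv m.
apply/quot_nbhsP; exists p => y Exy /=; rewrite qinvE; apply: nV.
have := mP _ (pP _ Exy).
by rewrite tg_invMg !tg_invgK -!tg_mulA tg_mulgV tg_mulg1.
Qed.

Lemma quot_accessible : accessible_space quot.
Proof.
move=> u v; elim/quotW: u; elim/quotW: v => y x /eqP xy.
have [n nxy] : exists n, ~ E n (inv x ** y).
  by apply/existsNP => h; apply: xy; apply/qpi_eq.
exists ([set w | w <> qpi y]°); split; first exact: open_interior.
  apply/mem_set/quot_nbhsP; have [m mP] := chain_mul n; exists m => z Exz.
  move=> /= /qpi_eq zy; apply: nxy.
  by have := mP _ _ Exz (zy m); rewrite -tg_mulA tg_mulVKg.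
by apply/mem_set => /interior_subset; exact.
Qed.

Definition quot_topGroup : topGroup :=
  @TopGroup quot qmul qinv (qpi one) qmulA qmul1g qmulVg qmul_cont qinv_cont
    (uniform_tychonoff _ quot_accessible).

Lemma chain_cover n : aleph0_bounded G ->
  exists g : nat -> G, forall x, exists k, E n (inv (g k) ** x).
Proof. by move=> bG; apply: aleph0_bounded_nbhs => //; exact: chain_nbhs. Qed.

Lemma quot_aleph0_bounded : aleph0_bounded G -> aleph0_bounded quot_topGroup.
Proof.
move=> bG U [oU U1]; have /quot_nbhsP[n nU] : nbhs (qpi one) U.
  exact: open_nbhs_nbhs.
have [g gP] := chain_cover n bG; exists (fun k => qpi (g k)) => u _.
elim/quotW: u => x; have [k Ek] := gP x; exists k => //.
exists (qpi (inv (g k) ** x)); last by rewrite /= qmulE tg_mulVKg.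
by apply: nU; rewrite tg_inv1 tg_mul1g.
Qed.

Lemma quot_countable_base : aleph0_bounded G ->
  exists2 B : set (set quot), is_base B & countable B.
Proof.
move=> bG; have /choice[g gP] n := chain_cover n bG.
(* [p.1.1] selects a cover by translates, [p.1.2] a centre in it, and [p.2] the radius. *)
pose b (p : nat * nat * nat) : set quot :=
  [set qpi y | y in [set y | E p.2 (inv (g p.1.1 p.1.2) ** y)]]°.
exists (range b); last first.
  by apply: sub_countable (card_image_le _ _) _; exact: countableP.
split=> [_ [p _ <-]|U oU u]; first exact: open_interior.
elim/quotW: u => x Ux; have /quot_nbhsP[n nU] : nbhs (qpi x) U.
  exact: open_nbhs_nbhs.
(* A centre close to [x] at scale [p] yields a ball of radius [m] that contains the ball of radius
   [p] at [x] and stays within [n] of [x]. *)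
have [m mP] := chain_div _ E n; have [p pP] := chain_mul m.
have [k Ek] := gP p x; exists (b (p, k, m)); first by exists (p, k, m).
split.
  apply/quot_nbhsP; exists p => y Exy; exists y => //=.
  by have := pP _ _ Ek Exy; rewrite -tg_mulA tg_mulVKg.
move=> _ /interior_subset [y /= Ey <-]; apply: nU.
have Em : E m (inv (g p k) ** x).
  by rewrite -(tg_mulg1 _ (_ ** _)); apply: pP => //; exact: chain1.
by have := mP _ _ Em Ey; rewrite tg_invMg tg_invgK -tg_mulA tg_mulVKg.
Qed.

(** Every neighbourhood of the identity in the quotient contains the image of some [E m], so covers
    by translates in [G] project. *)
Lemma quot_rothberger (X : set G) :
  rothberger_bounded (@tg_mul G) one X ->
  rothberger_bounded qmul (qpi one) (qpi @` X).
Proof.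
move=> rbX U nbU.
have /choice[m mP] n : exists m, forall y, E m y -> U n (qpi y).
  have /quot_nbhsP[m mU] : nbhs (qpi one) (U n) by exact: open_nbhs_nbhs.
  by exists m => y Ey; apply: mU; rewrite tg_inv1 tg_mul1g.
have [|g gP] := rbX (fun n => (E (m n))°).
  by move=> n; split; [exact: open_interior|exact: chain_nbhs].
exists (fun n => qpi (g n)) => _ [x /gP[n _ [y Ey <-]] <-].
exists n => //; exists (qpi y); last exact: qmulE.
by apply: mP; exact: interior_subset Ey.
Qed.

End ChainQuotient.

(** * Finite and countable bases of accessible spaces *)

(** A point is determined by which members of the base contain it. *)
Lemma accessible_finite_base {T : topologicalType} (B : set (set T)) :
  accessible_space T -> is_base B -> finite_set B -> finite_set [set: T].
Proof.
move=> accT [_ baseB] /finite_seqP[s sB].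
pose g (x : T) : (size s).-tuple bool := map_tuple (fun V => `[< V x >]) (in_tuple s).
apply: card_le_finite (finite_finset : finite_set [set: (size s).-tuple bool]).
apply: (card_le_fun g) => // x y _ _ gxy; apply: contrapT => /eqP xy.
have [A [oA /set_mem Ax /set_mem Ay]] := accT x y xy.
have [V BV [Vx VA]] := baseB A oA x Ax.
have Vs : V \in s by move: BV; rewrite sB.
have := congr1 (fun t : (size s).-tuple bool => nth false t (index V s)) gxy.
rewrite /= !(nth_map V) ?index_mem // !nth_index // => e.
by apply: Ay; apply: VA; apply/asboolP; rewrite -e; exact/asboolP.
Qed.

Lemma countable_base_weight {T : topologicalType} (B : set (set T)) :
  accessible_space T -> infinite_set [set: T] -> is_base B -> countable B ->
  has_weight T [set: nat].
Proof.
move=> accT infT baseB ctB; split.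
  exists B => //; apply: eq_card_nat => // finB.
  by apply: infT; exact: accessible_finite_base finB.
move=> B' baseB'; apply/infiniteP => finB'.
by apply: infT; exact: accessible_finite_base finB'.
Qed.

(** * Borel's Conjecture and countable quotients *)

Lemma BC_countable_quotient (G : topGroup) (X : set G) (W : nat -> set G) :
  BorelConjecture -> aleph0_bounded G ->
  rothberger_bounded (@tg_mul G) (tg_one G) X ->
  (forall n, nbhs (tg_one G) (W n)) ->
  exists (E : nat -> set G) (c : G -> nat), [/\
    (forall n, nbhs (tg_one G) (E n)),
    (forall x, (forall n, E n x) -> forall n, W n x) &
    (forall x y, X x -> X y ->
      c x = c y <-> forall n, E n (tg_mul (tg_inv x) y))].
Proof.
move=> BC bG rbX W1; have [E EW] := ex_nbhs_chain G W bG W1.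
have ctX : qpi G E @` X #<= [set: nat].
  (* A finite quotient does not have weight aleph_0 and is treated apart. *)
  have [finQ|infQ] := pselect (finite_set [set: quot G E]).
    by apply: finite_set_countable; exact: sub_finite_set finQ.
  have [B baseB ctB] := quot_countable_base G E bG.
  apply: (BC (quot_topGroup G E)); last exact: quot_rothberger.
    exact: quot_aleph0_bounded.
  exact: countable_base_weight (quot_accessible G E) infQ baseB ctB.
have [c [_ cinj]] := card_leP_fun 0%N ctX.
exists E, (c \o qpi G E); split=> [n|//|x y Xx Xy]; first exact: chain_nbhs.
split=> [/= cxy|xy /=]; last by congr c; apply/qpi_eq.
by apply/qpi_eq; apply: cinj.
Qed.

(** * A Kurepa family from a large Rothberger bounded set *)

Lemma BC_not_KH_aleph1_BC_card (K : Type) : ~ countable [set: K] ->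
  BorelConjecture -> ~ KH_aleph1 K -> BC_card [set: K].
Proof.
move=> uncK BC nKH G bG [[B baseB BK] _] X rbX; apply: contrapT => nXK.
apply: nKH.
have infK : infinite_set [set: K] by move=> /finite_set_countable.
have [k0 _] := infinite_setN0 infK.
have infB : infinite_set B by rewrite (eq_finite_set BK).
pose good V := B V /\ V (tg_one G).
have /choice[E /choice[c EcP]] V : exists (E : nat -> set G) (c : G -> nat), [/\
    (forall n, nbhs (tg_one G) (E n)),
    (good V -> forall x, (forall n, E n x) -> V x) &
    (forall x y, X x -> X y ->
      c x = c y <-> forall n, E n (tg_mul (tg_inv x) y))].
  (* For [V] that is not [good] the condition holds everywhere, so [E] and [c] can be chosen for all
     [V]. *)
  have [|E [c [E1 EW cE]]] := BC_countable_quotient G X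
      (fun=> [set x | good V -> V x]) BC bG rbX.
    move=> _; have [gV|nV] := pselect (good V).
      have [BV V1] := gV; apply: (@filterS _ _ _ V) => [x Vx _ //|].
      by apply: open_nbhs_nbhs; split=> //; have [oB _] := baseB; exact: oB.
    by apply: filterS filterT => x _ /nV.
  by exists E, c; split=> // gV x /EW/(_ 0%N); exact.
have [e [_ einj]] : exists e : set G * nat -> K,
    (forall p, (B `*` [set: nat]) p -> [set: K] (e p)) /\
    (forall p q, (B `*` [set: nat]) p -> (B `*` [set: nat]) q -> e p = e q -> p = q).
  apply: (card_leP_fun k0); rewrite -(card_le_eqr BK); exact: card_setX_nat_le.
pose code (x : G) : set K := [set e (V, c V x) | V in good].
have codeP x V m : good V -> code x (e (V, m)) <-> c V x = m.
  move=> gV; split=> [[V' gV' /einj h]|<-]; last by exists V.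
  by have [<- <-] : (V', c V' x) = (V, m)
    by apply: h; split=> //; [case: gV'|case: gV].
(* Equal coset numbers for all [V] put [inv x ** y] in every base set around the identity, so it is
   the identity by accessibility. *)
have cV x y : X x -> X y -> (forall V, good V -> c V x = c V y) -> x = y.
  move=> Xx Xy cxy; suff xy1 : tg_mul (tg_inv x) y = tg_one G.
    by rewrite -[RHS](tg_mulVKg G x) xy1 tg_mulg1.
  apply: contrapT => /eqP; rewrite eq_sym => ne.
  have [accG _] := tg_tych G.
  have [A [oA /set_mem A1 /set_mem nA]] := accG _ _ ne.
  have [V BV [V1 VA]] := baseB.2 A oA _ A1.
  have gV : good V by [].
  apply: nA; apply: VA; have [_ EV cE] := EcP V.
  by apply: EV => //; apply/cE => //; exact: cxy.
exists (code @` X); split.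
  have XF : X #<= code @` X.
    apply: (card_le_fun code) => [x Xx|x y Xx Xy xy]; first by exists x.
    by apply: cV => // V gV; apply/esym/codeP => //; rewrite -xy; exact/codeP.
  split; last by move=> FK; apply: nXK; exact: card_le_trans XF FK.
  have [//|FK] := card_le_total [set: K] (code @` X).
  by case: nXK; exact: card_le_trans XF FK.
move=> A infA ctA.
have [i [_ iinj]] := card_leP_fun 0%N ctA.
(* [v] enumerates the countably many good [V] for which some [e (V, m)] lies in [A]; [setT] is a
   mere filler. *)
have /choice[v vP] n : exists V, forall V' m, good V' -> A (e (V', m)) ->
    i (e (V', m)) = n -> V = V'.
  have [[V [m [gV Ae ie]]]|nV] :=
      pselect (exists V m, [/\ good V, A (e (V, m)) & i (e (V, m)) = n]).
    exists V => V' m' gV' Ae' ie'.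
    have /einj h : e (V, m) = e (V', m') by apply: iinj; rewrite ?ie.
    by have [] : (V, m) = (V', m') by apply: h; split=> //; [case: gV|case: gV'].
  by exists setT => V m gV Ae ie; case: nV; exists V, m.
pose dec n : nat * nat := odflt (0, 0)%N (unpickle n).
(* A single chain refines all the [E (v n)] at once, so the number [c' x] determines the whole trace
   of [code x] on [A]; such numbers are countably many. *)
have [|E' [c' [_ EW' cE']]] := BC_countable_quotient G X
    (fun n => E (v (dec n).1) (dec n).2) BC bG rbX.
  by move=> n; have [+ _ _] := EcP (v (dec n).1); exact.
have c'c x y : X x -> X y -> c' x = c' y -> forall n, c (v n) x = c (v n) y.
  move=> Xx Xy /(cE' _ _ Xx Xy) /EW' Exy n; have [_ _ cE] := EcP (v n).
  by apply/cE => // k; have := Exy (pickle (n, k)); rewrite /dec pickleK.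
have half x y : X x -> X y -> c' x = c' y -> code x `&` A `<=` code y `&` A.
  move=> Xx Xy cxy k [[V gV <-] Ak]; split=> //; apply/codeP => //.
  by have := c'c _ _ Xx Xy cxy (i (e (V, c V x))); rewrite (vP _ V (c V x)).
apply: card_le_trans (iffLR (infiniteP A) infA).
apply: (card_le_rel (fun T n => exists x, [/\ X x, T = code x `&` A & c' x = n])).
  by move=> _ [_ [x Xx <-] <-]; exists (c' x) => //; exists x.
move=> T T' n _ _ [x [Xx -> cx]] [y [Xy -> cy]].
by apply/seteqP; split; apply: half => //; rewrite cx cy.
Qed.

(** Cardinals below that of [K] are represented by subsets of [K]; by [BC_card_eq] the choice of
    representatives is immaterial. *)
Theorem theorem14 (K : Type) (K_uncountable : ~ countable [set: K]) :
  (* (1) -> (2) -> (3) -> (4) *)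
  (BC_card [set: K] -> BC_cantor K) /\
  (BC_cantor K -> ~ KH_aleph1 K) /\
  (~ KH_aleph1 K -> ~ KH_kappa K) /\
  (* under BC, (1) <-> (2) <-> (3) *)
  (BorelConjecture ->
     (BC_card [set: K] <-> BC_cantor K) /\ (BC_cantor K <-> ~ KH_aleph1 K)) /\
  (* if BC_lambda for all infinite lambda < kappa, all four are equivalent *)
  ((forall Lam : set K, infinite_set Lam -> card_lt Lam [set: K] -> BC_card Lam) ->
     (BC_card [set: K] <-> BC_cantor K) /\ (BC_cantor K <-> ~ KH_aleph1 K) /\
     (~ KH_aleph1 K <-> ~ KH_kappa K)).
Proof.
have infK : infinite_set [set: K] by move=> /finite_set_countable.
have H12 := BC_card_cantor K infK.
have H23 := BC_cantor_not_KH_aleph1 K K_uncountable.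
have H34 : ~ KH_aleph1 K -> ~ KH_kappa K.
  by apply: contra_not; exact: KH_kappa_KH_aleph1.
have H31 := BC_not_KH_aleph1_BC_card K K_uncountable.
split; first exact: H12.
split; first exact: H23.
split; first exact: H34.
have H : BorelConjecture ->
    (BC_card [set: K] <-> BC_cantor K) /\ (BC_cantor K <-> ~ KH_aleph1 K).
  by move=> /H31 {}H31; split; split=> // h; [apply: H31; exact: H23|apply: H12; exact: H31].
split=> // BClt.
have [h12 h23] := H (BC_below_BorelConjecture K K_uncountable BClt).
split=> //; split=> //; split=> //.
by apply: contra_not; exact: KH_aleph1_KH_kappa.
Qed.
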